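(* There exists a probabilistic online monotone embedding from $\ell_\infty^D$ into HSTs with distortion $O(Dl)$, where $l$ is the width of the update sequence.
   Context: $\ell_\infty^D$ is $\mathbb R^D$ with $d(u,v)=\max_i|u_i-v_i|$. For $\mu\ge1$, a $\mu$-HST is the metric on the leaves of a rooted tree with node weights $\varphi\ge0$ ($\varphi(v)=0$ iff $v$ is a leaf, $\varphi(v)\le\varphi(u)/\mu$ when $v$ is a child of $u$), leaf distance $\varphi(\mathrm{lca}(u,v))$; ''HSTs'' is the family of such metrics. An update sequence is a sequence $(v_t,o_t)\in\mathbb R^D\times\{+,-\}$ ($v_t$ arrives if $o_t=+$, leaves if $o_t=-$) with alive sets $L_0=\varnothing$, $L_t=L_{t-1}\cup\{v_t\}$ or $L_{t-1}\setminus\{v_t\}$; its width is $\max_t|L_t|$. A deterministic online monotone embedding outputs after $\sigma_t$ (depending only on $\sigma_1,\dots,\sigma_t$) an HST metric $d_t$ on $L_t$ with $d_t\ge d$ on $L_t$ and $d_t(u,v)\le d_{t-1}(u,v)$ on $L_{t-1}\cap L_t$; a probabilistic one is a distribution over these (sequence fixed independently of the randomness). Distortion $O(Dl)$ means $\mathbb E[d_t(u,v)]\le C\,D\,l\,d(u,v)$ for an absolute constant $C$, every update sequence of width $l$, every $t$ and $u,v\in L_t$. *)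

(* Defs.v *)
From HB Require Import structures.
From mathcomp Require Import all_boot all_order all_algebra.
From mathcomp Require Import all_classical all_reals all_analysis.
Set Implicit Arguments. Unset Strict Implicit. Unset Printing Implicit Defensive.
Import Order.TTheory GRing.Theory Num.Theory.
Local Open Scope ring_scope.

Section HSTDefs.
Variables (R : realType) (D : nat).

Definition pt := 'rV[R]_D.

Definition linf (u v : pt) : R :=
  \big[Num.max/0]_(i < D) `|u ord0 i - v ord0 i|.

(* an update: (v, true) = arrival of v, (v, false) = departure of v *)
Definition upd := (pt * bool)%type.

Definition alive_step (L : seq pt) (e : upd) : seq pt :=
  let: (v, o) := e in
  if o then (if v \in L then L else rcons L v) else seq.filter (predC1 v) L.

Definition alive (s : seq upd) : seq pt := foldl alive_step [::] s.

Definition width (s : seq upd) : nat :=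
  \max_(t < (size s).+1) size (alive (take t s)).

Inductive tree : Type :=
| Leaf of pt
| Node of R & seq tree.

Definition weight (T : tree) : R :=
  match T with Leaf _ => 0 | Node w _ => w end.

Fixpoint leaves (T : tree) : seq pt :=
  match T with
  | Leaf x => [:: x]
  | Node _ cs => flatten (map leaves cs)
  end.

Fixpoint hst_ok (mu : R) (T : tree) : bool :=
  match T with
  | Leaf _ => true
  | Node w cs => [&& 0 < w, ~~ nilp cs &
                    all (fun c => (weight c <= w / mu) && hst_ok mu c) cs]
  end.

Definition is_HST (T : tree) : Prop := exists mu : R, 1 <= mu /\ hst_ok mu T.

Fixpoint lca_weight (T : tree) (u v : pt) : R :=
  match T with
  | Leaf _ => 0
  | Node w cs =>
      let fix go (cs : seq tree) : R :=
        match cs with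
        | [::] => w
        | c :: cs' => if (u \in leaves c) && (v \in leaves c)
                      then lca_weight c u v else go cs'
        end in go cs
  end.

Definition hst_dist (T : tree) (u v : pt) : R :=
  if u == v then 0 else lca_weight T u v.

(* deterministic online monotone embedding: the output after the prefix s
   (depending only on s) is an HST whose leaf set is L_t, dominating d,
   and non-increasing on points alive at consecutive times *)
Definition online_monotone_embedding (A : seq upd -> tree) : Prop :=
  forall s : seq upd,
    (alive s != [::] -> is_HST (A s) /\ perm_eq (leaves (A s)) (alive s)) /\
    (forall u v, u \in alive s -> v \in alive s -> linf u v <= hst_dist (A s) u v) /\
    (forall (e : upd) u v, u \in alive s -> v \in alive s ->
        u \in alive (rcons s e) -> v \in alive (rcons s e) ->
        hst_dist (A (rcons s e)) u v <= hst_dist (A s) u v).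

End HSTDefs.

(* Main.v *)
Require Import Defs.
From HB Require Import structures.
From mathcomp Require Import all_boot all_order all_algebra.
From mathcomp Require Import all_classical all_reals all_analysis.
From mathcomp Require Import measurable_realfun.
From mathcomp Require Import ring lra zify.
Import Order.TTheory GRing.Theory Num.Theory.
Local Open Scope ring_scope.

Set Implicit Arguments. Unset Strict Implicit. Unset Printing Implicit Defensive.

(** For every scale [2^i], [i] an integer, cut the space into cubes of side [2^i]
    shifted in every coordinate by [2^i] times one uniform number (only union
    bounds are taken, so the same number serves all scales), and maintain a
    partition of the alive points into clusters: a point joins the cluster of the
    cell it falls in, and whenever an alive point [z] has no alive point at
    distance in (2^i/2, 4*2^i], all points within 2^i/2 of [z] are merged.
    Clusters only ever merge and keep diameter at most 3*2^i, since a cluster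
    always lies in the cells meeting a set of diameter 2^i.  The distance
    [sup {8*2^i | u, v in different clusters at scale i}] is then an ultrametric,
    hence an HST with mu = 1; it dominates the original metric and never increases.

    A pair at distance [delta] is separated at a scale [2^i >= 2 delta] only if the
    shifted grid cuts it, which has probability O(D delta / 2^i), and some alive
    point lies in the annulus around [u] at that scale, which each point does for
    at most four scales.  So O(l) scales contribute O(D delta) each. *)

(** * The supremum metric *)

Section LinfMetric.
Variables (R : realType) (D : nat).
Implicit Types u v w : pt R D.

Lemma linf_leP u v (r : R) : 0 <= r ->
  reflect (forall k, `|u ord0 k - v ord0 k| <= r) (linf u v <= r).
Proof.
move=> r0; apply: (iffP idP) => [uvr k|uvr].
  exact: le_trans (le_bigmax _ _ k) uvr.
by apply: bigmax_le.
Qed.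

Lemma ler_linf u v k : `|u ord0 k - v ord0 k| <= linf u v.
Proof. exact: le_bigmax. Qed.

Lemma linf_ge0 u v : 0 <= linf u v.
Proof. exact: bigmax_ge_id. Qed.

Lemma linfC u v : linf u v = linf v u.
Proof. by apply: eq_bigr => k _; rewrite distrC. Qed.

Lemma linfxx u : linf u u = 0.
Proof.
apply/eqP; rewrite eq_le linf_ge0 andbT; apply/linf_leP => // k.
by rewrite subrr normr0.
Qed.

Lemma linf_triangle v u w : linf u w <= linf u v + linf v w.
Proof.
apply/linf_leP => [|k]; first by rewrite addr_ge0 ?linf_ge0.
apply: le_trans (ler_distD (v ord0 k) _ _) _.
by rewrite lerD ?ler_linf.
Qed.

Lemma linf_gt0 u v : u != v -> 0 < linf u v.
Proof.
move=> uv; rewrite lt_neqAle linf_ge0 andbT; apply: contra uv => /eqP uv0.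
apply/eqP/rowP => k; apply/eqP; rewrite -subr_eq0 -normr_le0 uv0.
exact: ler_linf.
Qed.

End LinfMetric.

(** * Alive sets and width *)

Section Alive.
Variables (R : realType) (D : nat).
Implicit Types (s : seq (upd R D)).

Lemma alive_rcons s e : alive (rcons s e) = alive_step (alive s) e.
Proof. by rewrite /alive foldl_rcons. Qed.

Lemma alive_uniq s : uniq (alive s).
Proof.
elim/last_ind: s => // s [v o] us; rewrite alive_rcons /=.
case: o; last exact: filter_uniq.
by case: ifPn => // vs; rewrite rcons_uniq vs.
Qed.

Lemma size_alive_le_width s t : (size (alive (take t s)) <= width s)%N.
Proof.
have [ts|/ltnW st] := leqP t (size s).
  exact: (leq_bigmax (Ordinal (n := (size s).+1) (m := t) ts)).
(* The maximum in [width] stops at [size s]; longer prefixes are [s] itself. *)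
rewrite take_oversize // -{1}(take_size s).
exact: (leq_bigmax (Ordinal (n := (size s).+1) (m := size s) (ltnSn _))).
Qed.

End Alive.

(** * Clusters at a single scale [r] *)

Section Clusters.
Variables (R : realType) (D : nat) (same : rel (pt R D)) (r : R).
Implicit Types (L : seq (pt R D)) (e : rel (pt R D)) (s : seq (upd R D)).

Definition isolated_in L z := all (fun x => (linf x z <= 4 * r) ==> (linf x z <= r / 2)) L.

Definition clumped L u v :=
  has (fun z => [&& isolated_in L z, linf u z <= r / 2 & linf v z <= r / 2]) L.

(** An arrival needs no case of its own: the relation lives on the whole space and reaches a new
    point through old alive points [a], [b] of the cells. *)
Definition extend L e u v :=
  same u v || has (fun a => same u a && has (fun b => same v b && e a b) L) L.

Definition merge L L' e u v := extend L e u v || clumped L' u v.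

Fixpoint cluster_rev (s : seq (upd R D)) : rel (pt R D) :=
  if s is _ :: s' then merge (alive (rev s')) (alive (rev s)) (cluster_rev s')
  else fun _ _ => false.

Definition same_cluster s := cluster_rev (rev s).

Lemma cluster_rcons s (e : upd R D) :
  same_cluster (rcons s e) = merge (alive s) (alive (rcons s e)) (same_cluster s).
Proof.
by rewrite /same_cluster rev_rcons /= revK -(rev_rcons s e) revK.
Qed.

Hypothesis same_refl : reflexive same.
Hypothesis same_sym : symmetric same.
Hypothesis same_trans : transitive same.
Hypothesis same_linf : forall u v, same u v -> linf u v <= r.
Hypothesis r_ge0 : 0 <= r.

(* Cells meeting a common set of diameter [r]: the invariant that keeps clusters
   small, since arrivals only join cells that the same_cluster already meets. *)
Definition cell_near u v := exists x y, [/\ same u x, same v y & linf x y <= r].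

Lemma cell_near_linf u v : cell_near u v -> linf u v <= 3 * r.
Proof.
move=> [x [y [/same_linf ux /same_linf vy xy]]].
have := linf_triangle x u v; have := linf_triangle y x v; rewrite (linfC y v); lra.
Qed.

(** For reflexive [same] the first clause also gives reflexivity, so on [L] this is an equivalence
    relation coarser than the cells, with small classes. *)
Definition cluster_inv L e :=
  [/\ {in L &, forall u v, same u v -> e u v},
      {in L &, forall u v, e u v -> e v u},
      {in L & &, forall v u w, e u v -> e v w -> e u w} &
      {in L &, forall u v, e u v -> cell_near u v}].

Lemma extendP L e u v :
  reflect (same u v \/ exists a b, [/\ a \in L, b \in L, same u a, same v b & e a b])
          (extend L e u v).
Proof.
apply: (iffP orP) => -[uv|]; try by left.
  move=> /hasP[a aL /andP[ua /hasP[b bL /andP[vb ab]]]].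
  by right; exists a, b.
move=> [a [b [aL bL ua vb ab]]]; right; apply/hasP; exists a => //.
by rewrite ua; apply/hasP; exists b => //; rewrite vb.
Qed.

Lemma extend_sym L e u v : cluster_inv L e -> extend L e u v -> extend L e v u.
Proof.
move=> [_ esym _ _] /extendP[uv|[a [b [aL bL ua vb ab]]]]; apply/extendP.
  by left; rewrite same_sym.
by right; exists b, a; split => //; apply: esym.
Qed.

Lemma extend_trans L e v u w : cluster_inv L e ->
  extend L e u v -> extend L e v w -> extend L e u w.
Proof.
move=> [esame _ etrans _] /extendP[uv|[a [b [aL bL ua vb ab]]]]
  /extendP[vw|[c [d [cL dL vc wd cd]]]]; apply/extendP.
- by left; apply: same_trans vw.
- by right; exists c, d; split => //; apply: same_trans vc.
- by right; exists a, b; split => //; apply: same_trans vb; rewrite same_sym.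
(* Both [b] and [c] lie in the cell of [v], so [a] and [d] already share an old cluster. *)
- right; exists a, d; split => //; apply: (etrans c) => //.
  apply: (etrans b) => //; apply: esame => //.
  by apply: same_trans vc; rewrite same_sym.
Qed.

(** The witnesses found for [a] and [b] serve [u] and [v] too, which lie in the same cells; hence
    repeated extension does not enlarge the diameter bound. *)
Lemma extend_cell_near L e u v : cluster_inv L e -> extend L e u v -> cell_near u v.
Proof.
move=> [_ _ _ enear] /extendP[uv|[a [b [aL bL ua vb ab]]]].
  by exists v, v; rewrite same_refl linfxx.
have [x [y [ax by_ xy]]] := enear _ _ aL bL ab.
by exists x, y; split => //; [apply: same_trans ax|apply: same_trans by_].
Qed.

Lemma clumpedP L u v :
  reflect (exists z : pt R D, [/\ z \in L, isolated_in L z, linf u z <= r / 2 & linf v z <= r / 2])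
          (clumped L u v).
Proof.
apply: (iffP hasP) => [[z zL /and3P[]]|[z [zL iz uz vz]]]; first by exists z.
by exists z => //; apply/and3P.
Qed.

Lemma clumped_sym L u v : clumped L u v -> clumped L v u.
Proof.
by move=> /clumpedP[z [zL iz uz vz]]; apply/clumpedP; exists z.
Qed.

Lemma clumped_near L u v : clumped L u v -> cell_near u v.
Proof.
move=> /clumpedP[z [zL iz uz vz]]; exists u, v; split => //.
move: (linf_triangle z u v) uz vz; rewrite (linfC z v).
by move: (linf u v) (linf u z) (linf v z) => a b c; lra.
Qed.

(** This is why the outer radius is [4 * r]: [u] is within [3 * r + r / 2] of the isolated centre
    [z], hence within [r / 2]. A clump swallows whole every cluster it meets, which keeps [merge]
    transitive. *)
Lemma clumped_absorb L u v w : u \in L -> cell_near u v -> clumped L v w -> clumped L u w.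
Proof.
move=> uL /cell_near_linf uv /clumpedP[z [zL iz vz wz]]; apply/clumpedP; exists z.
split => //; move/allP: (iz) => /(_ u uL) /implyP; apply.
move: (linf_triangle v u z) uv vz.
by move: r_ge0 (linf u v) (linf u z) (linf v z) => r0 a b c; lra.
Qed.

Lemma merge_inv L L' e : cluster_inv L e -> cluster_inv L' (merge L L' e).
Proof.
move=> inv; rewrite /merge; split => [u v uL vL uv|u v uL vL|v u w vL uL wL|u v uL vL].
- by rewrite /extend uv.
- by case/orP => [/(extend_sym inv) ->//|/clumped_sym ->]; rewrite orbT.
- case/orP => uv /orP[] vw.
  + by rewrite (extend_trans inv uv vw).
  + by rewrite (clumped_absorb uL _ vw) ?orbT //; apply: extend_cell_near uv.
  + apply/orP; right; apply/clumped_sym; apply: clumped_absorb (clumped_sym uv) => //.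
    exact/(extend_cell_near inv)/(extend_sym inv).
  + apply/orP; right; apply: clumped_absorb vw => //; exact: clumped_near uv.
- by case/orP => [/(extend_cell_near inv)|/clumped_near].
Qed.

Lemma clusterP s : cluster_inv (alive s) (same_cluster s).
Proof.
elim/last_ind: s => [|s e IH]; last by rewrite cluster_rcons; apply: merge_inv.
by split.
Qed.

Lemma cluster_mono s (e : upd R D) u v : u \in alive s -> v \in alive s ->
  same_cluster s u v -> same_cluster (rcons s e) u v.
Proof.
move=> us vs uv; rewrite cluster_rcons /merge; apply/orP; left; apply/extendP.
by right; exists u, v; split.
Qed.

(** Source of the distortion bound: cells lie inside clusters, and an isolated [u] is the centre of
    a clump of its own, so a point outside its cluster must be far. *)
Lemma not_cluster s u v : u \in alive s -> ~~ same_cluster s u v ->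
  ~~ same u v /\ (isolated_in (alive s) u -> r / 2 < linf u v).
Proof.
elim/last_ind: s => // s e _ us.
rewrite cluster_rcons /merge negb_or /extend negb_or => /andP[/andP[-> _] ncl].
split => // iu; rewrite ltNge; apply: contra ncl => uv.
by apply/clumpedP; exists u; rewrite iu linfxx linfC uv divr_ge0.
Qed.

Lemma cluster_linf s u v : u \in alive s -> v \in alive s ->
  same_cluster s u v -> linf u v <= 3 * r.
Proof. by move=> us vs uv; apply/cell_near_linf; case: (clusterP s) => _ _ _; apply. Qed.

End Clusters.

(** * Measurability of the clusters in the random shift *)

Section ClusterMeasurable.
Variables (R : realType) (D : nat) (d : measure_display) (T : measurableType d).
Variables (same : T -> rel (pt R D)) (r : R).
Hypothesis same_meas : forall u v, measurable_fun setT (fun w => same w u v).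

Lemma measurable_fun_has (I : Type) (L : seq I) (f : T -> I -> bool) :
  (forall a, measurable_fun setT (f ^~ a)) ->
  measurable_fun setT (fun w => has (f w) L).
Proof.
move=> mf; elim: L => [|a L IH] /=; first exact: measurable_cst.
exact: measurable_or.
Qed.

(** Only [same] is random; the alive sets, and with them [clumped], are deterministic. *)
Lemma measurable_cluster s u v : measurable_fun setT (fun w => same_cluster (same w) r s u v).
Proof.
elim/last_ind: s u v => [|s e IH] u v; first exact: measurable_cst.
under eq_fun do rewrite cluster_rcons /merge /extend.
apply: measurable_or; last exact: measurable_cst.
apply: measurable_or => //; apply: measurable_fun_has => a.
apply: measurable_and => //; apply: measurable_fun_has => b.
exact: measurable_and.
Qed.

End ClusterMeasurable.

(** * Finite ultrametrics as leaf distances of trees *)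

Section UltrametricTree.
Variables (R : realType) (D : nat).
Implicit Types (dist : pt R D -> pt R D -> R) (L : seq (pt R D)) (T : tree R D).

Lemma seq_argmax (T : eqType) (f : T -> R) (s : seq T) : s != [::] ->
  exists2 y, y \in s & {in s, forall z, f z <= f y}.
Proof.
elim: s => // x [|x' s] IH _.
  by exists x; rewrite ?mem_seq1 // => z; rewrite mem_seq1 => /eqP ->.
have [//|y ys ymax] := IH.
have [xy|/ltW yx] := leP (f x) (f y).
  exists y; first by rewrite inE ys orbT.
  by move=> z; rewrite inE => /orP[/eqP -> //|]; apply: ymax.
exists x; first by rewrite inE eqxx.
move=> z; rewrite inE => /orP[/eqP -> //|/ymax zy]; exact: le_trans yx.
Qed.

Definition ultrametric_on L dist :=
  [/\ {in L &, forall u v, u != v -> 0 < dist u v},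
      {in L &, forall u v, dist u v = dist v u} &
      {in L & &, forall u v w, dist u w <= Num.max (dist u v) (dist v w)}].

Lemma sub_ultrametric L L' dist : {subset L' <= L} ->
  ultrametric_on L dist -> ultrametric_on L' dist.
Proof.
by move=> sL [dpos dsym dtri]; split => [u v uL vL|u v uL vL|u v w uL vL wL];
  [apply: dpos|apply: dsym|apply: dtri]; apply: sL.
Qed.

Lemma lca_weight_node2 w T1 T2 u v :
  lca_weight (Node w [:: T1; T2]) u v =
  if (u \in leaves T1) && (v \in leaves T1) then lca_weight T1 u v
  else if (u \in leaves T2) && (v \in leaves T2) then lca_weight T2 u v else w.
Proof. by []. Qed.

(* The condition on the root weight is there for the induction: it makes the
   trees of the two parts fit below their common parent. *)
Lemma ultrametric_tree L dist : uniq L -> L != [::] -> ultrametric_on L dist ->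
  exists T, [/\ perm_eq (leaves T) L, hst_ok 1 T,
    {in L &, forall u v, u != v -> lca_weight T u v = dist u v} &
    forall B, 0 <= B -> {in L &, forall u v, u != v -> dist u v <= B} -> weight T <= B].
Proof.
have [n] := ubnP (size L); elim: n => // n IH in L *.
case: L => // x L sizeL uniqL _ dultra; have [dpos dsym dtri] := dultra.
have [L0|L0] := eqVneq L [::].
  exists (Leaf x); rewrite L0; split => // u v.
  by rewrite !inE => /eqP -> /eqP ->; rewrite eqxx.
have [y yL ymax] := seq_argmax (dist x) L0.
have xM : x \in x :: L by rewrite inE eqxx.
have LM z : z \in L -> z \in x :: L by rewrite inE orbC => ->.
have nxL z : z \in L -> x != z.
  by move=> zL; apply: contraTneq zL => <-; case/andP: uniqL.
(* The root weight [w] is the largest distance from [x]. Points nearer to [x] join [x] in [L1],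
   those at distance exactly [w] form [L2]; as [x] and [y] are separated, both parts are smaller. *)
pose w := dist x y; pose near := fun z => dist x z < w.
pose L1 := x :: [seq z <- L | near z]; pose L2 := [seq z <- L | ~~ near z].
have w0 : 0 < w := dpos x y xM (LM y yL) (nxL y yL).
have perm12 : perm_eq (L1 ++ L2) (x :: L) by rewrite /= perm_cons perm_filterC.
have s1 : {subset L1 <= x :: L}.
  by move=> z zL1; rewrite -(perm_mem perm12) mem_cat zL1.
have s2 : {subset L2 <= x :: L}.
  by move=> z zL2; rewrite -(perm_mem perm12) mem_cat zL2 orbT.
have yL2 : y \in L2 by rewrite mem_filter /near ltxx yL.
have L1_lt a : a \in L1 -> a = x \/ dist x a < w.
  by rewrite inE mem_filter => /orP[/eqP|/andP[]]; [left|right].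
have uniq12 : uniq (L1 ++ L2) by rewrite (perm_uniq perm12).
have dist12 a : a \in L1 -> a \notin L2.
  move: uniq12; rewrite cat_uniq => /and3P[_ /hasPn h _] aL1.
  by apply: contraL aL1; apply: h.
have dle_x a : a \in x :: L -> a != x -> dist x a <= w.
  by rewrite inE => /orP[-> //|aL _]; apply: ymax.
have dle a b : a \in x :: L -> b \in x :: L -> a != b -> dist a b <= w.
  move=> aL bL ab; have [ax|ax] := eqVneq a x.
    by rewrite ax dle_x // -ax eq_sym.
  have [bx|bx] := eqVneq b x; first by rewrite bx dsym // dle_x.
  apply: le_trans (dtri a x b aL xM bL) _.
  by rewrite ge_max (dsym a x) // !dle_x.
(* Isosceles triangles: when [dist x a < w <= dist x b], the ultrametric inequality leaves only
   [w <= dist a b]. *)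
have deq a b : a \in L1 -> b \in L2 -> dist a b = w.
  move=> aL1 bL2; have ab : a != b by apply: contraTneq bL2 => <-; apply: dist12.
  apply/eqP; rewrite eq_le (dle a b (s1 a aL1) (s2 b bL2) ab) /=.
  have xb : w <= dist x b by move: bL2; rewrite mem_filter /near -leNgt => /andP[].
  have [->//|xa] := L1_lt _ aL1.
  have := le_trans xb (dtri x a b xM (s1 _ aL1) (s2 _ bL2)).
  by rewrite le_max leNgt xa.
have [||||T1 [leaves1 ok1 lca1 weight1]] := IH L1.
- rewrite -ltnS; apply: leq_trans sizeL; rewrite /= !ltnS.
  rewrite -(count_predC near L) size_filter -addn1 leq_add2l -has_count.
  by apply/hasP; exists y => //=; rewrite /near ltxx.
- by move: uniq12; rewrite cat_uniq => /and3P[].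
- by [].
- exact: sub_ultrametric dultra.
have [||||T2 [leaves2 ok2 lca2 weight2]] := IH L2.
- rewrite -ltnS; apply: leq_trans sizeL; rewrite /= !ltnS.
  by rewrite size_filter count_size.
- by move: uniq12; rewrite cat_uniq => /and3P[].
- by apply: contraTneq yL2 => ->.
- exact: sub_ultrametric dultra.
exists (Node w [:: T1; T2]); split.
- by rewrite /= cats0 -(permPr perm12) perm_cat.
- rewrite /= w0 ok1 ok2 divr1 !andbT weight1 ?weight2 ?ltW //.
  + by move=> a b aL bL; apply: dle; apply: s2.
  + by move=> a b aL bL; apply: dle; apply: s1.
- move=> u v uL vL uv; rewrite lca_weight_node2 !(perm_mem leaves1) !(perm_mem leaves2).
  move: uL vL; rewrite -!(perm_mem perm12) !mem_cat.
  have [uL1 _|uL1 /= uL2] := boolP (u \in L1); have [vL1 _|vL1 /= vL2] := boolP (v \in L1) => /=.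
  + exact: lca1.
  + by rewrite (negbTE (dist12 _ uL1)) /= deq.
  + by rewrite (negbTE (dist12 _ vL1)) andbF (dsym _ _ (s2 u uL2) (s1 v vL1)) deq.
  + by rewrite uL2 vL2 lca2.
- by move=> B _ /(_ x y xM (LM y yL) (nxL y yL)).
Qed.

End UltrametricTree.

(** * Powers of two with integer exponents *)

Section DyadicScales.
Variable R : realType.

Lemma exp2z_gt0 (i : int) : 0 < (2 : R) ^ i.
Proof. exact: exprz_gt0. Qed.

Lemma exp2z_ge0 (i : int) : 0 <= (2 : R) ^ i.
Proof. exact/ltW/exp2z_gt0. Qed.

Lemma exp2zD (i j : int) : (2 : R) ^ (i + j) = 2 ^ i * 2 ^ j.
Proof. by rewrite expfzDr // pnatr_eq0. Qed.

Lemma exp2z_D2 (i : int) : (2 : R) ^ (i + 2) = 4 * 2 ^ i.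
Proof. by rewrite exp2zD mulrC; congr (_ * _); rewrite -exprnP; lra. Qed.

(** Shifting exponents by an [M] with [2 ^ (- M) < x] turns the search into one for a least natural
    number, which is then positive. *)
Lemma dyadic_bracket (x : R) : 0 < x -> exists j : int, 2 ^ j <= x < 2 ^ (j + 1).
Proof.
move=> x0; pose M := Num.bound x^-1; pose N := Num.bound x.
have xM : 2 ^ (- (M%:Z)) < x.
  rewrite -invr_expz -[ltRHS]invrK ltf_pV2 ?posrE ?invr_gt0 ?exp2z_gt0 //.
  exact: upper_nthrootP.
have exN : exists n : nat, x < 2 ^ (n%:Z - M%:Z).
  exists (N + M)%N; rewrite PoszD addrK; exact: upper_nthrootP.
case: (ex_minnP exN) => [[|n]] xn nmin; first by move: xn; rewrite sub0r ltNge ltW.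
exists (n%:Z - M%:Z); rewrite (_ : n%:Z - M%:Z + 1 = n.+1%:Z - M%:Z); last by lia.
by rewrite xn andbT leNgt; apply/negP => /nmin; rewrite ltnn.
Qed.

End DyadicScales.

(** * Cutting probability of a uniform shift *)

Section RandomShift.
Variable R : realType.
Local Open Scope classical_set_scope.

Definition shift_law : probability (measurableTypeR R) R := uniform_prob (@ltr01 R).

Definition split_by (x y w : R) : bool := Num.floor (x + w) != Num.floor (y + w).

Lemma measurable_split_by x y : measurable_fun setT (split_by x y).
Proof.
apply: measurable_neg.
have mfloor (z : R) : measurable_fun setT (fun w : R => (Num.floor (z + w))%:~R : R).
  apply: nondecreasing_measurable => // a b ab.
  by rewrite ler_int le_floor // lerD2l.
have := measurable_fun_eqr (mfloor x) (mfloor y).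
by apply: eq_measurable_fun => w _; rewrite eqr_int.
Qed.

Lemma split_by_sym x y : split_by x y = split_by y x.
Proof. by apply/funext => w; rewrite /split_by eq_sym. Qed.

(** For [x <= y] the floors differ iff some integer [m] has [x + w < m <= y + w], that is, [w] lies
    in [[m - y, m - x[]. As [0 <= w <= 1], [m] can be taken to be [floor x + 1] or [floor x + 2]:
    two intervals of length [y - x], hence the factor 2. *)
Lemma shift_law_split x y :
  (shift_law [set w | split_by x y w] <= (2 * `|x - y|)%:E)%E.
Proof.
wlog xy : x y / x <= y.
  move=> H; have [/H//|/ltW/H] := leP x y.
  by rewrite split_by_sym distrC.
pose A := [set w | split_by x y w]; rewrite -/A; pose n : R := (Num.floor x + 1)%:~R.
pose I1 := `[n - y, n - x[; pose I2 := `[(n + 1) - y, (n + 1) - x[.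
have mI1 : measurable I1 by exact: measurable_itv.
have mI2 : measurable I2 by exact: measurable_itv.
have mA : measurable A.
  have := measurable_split_by x y measurableT (Y := [set true]).
  by rewrite setTI; apply.
have AI : A `&` `[0, 1] `<=` I1 `|` I2.
  move=> w [/= /negP nfl]; rewrite in_itv /= => /andP[w0 w1].
  have lt_fl : (Num.floor (x + w) < Num.floor (y + w))%R.
    rewrite lt_neqAle le_floor ?lerD2r // andbT; exact/negP.
  have /andP[fx1 fx2] := floor_itv x; have /andP[fxw1 fxw2] := floor_itv (x + w).
  have fy : (Num.floor (x + w) + 1)%:~R <= y + w.
    by apply: le_trans (floor_le _); rewrite ler_int lezD1.
  have lb : Num.floor x <= Num.floor (x + w) by apply: le_floor; rewrite lerDl.
  have ub : Num.floor (x + w) <= Num.floor x + 1.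
    rewrite -ltzD1 floor_lt_int; apply: le_lt_trans (_ : x + 1 < _).
      by rewrite lerD2l.
    by rewrite intrD ltrD2r.
  have [e|e] : Num.floor (x + w) = Num.floor x \/ Num.floor (x + w) = Num.floor x + 1.
    move: lb ub; move: (Num.floor x) (Num.floor (x + w)) => a b; lia.
  - left; rewrite /I1 /= in_itv /=; move: fy fxw2; rewrite e -/n.
    by move=> h1 h2; apply/andP; split; lra.
  - right; rewrite /I2 /= in_itv /=; move: fy fxw2; rewrite e intrD -/n.
    by move=> h1 h2; apply/andP; split; lra.
(* The density is at most 1, so the probability is at most the Lebesgue measure of the two
   intervals. *)
rewrite /shift_law /= /uniform_prob integral_uniform_pdf.
apply: (@le_trans _ _ (\int[lebesgue_measure]_(z in I1 `|` I2) (uniform_pdf 0 1 z)%:E)%E).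
  apply: ge0_subset_integral => //.
  - exact: measurableI.
  - exact: measurableU.
  - apply/measurable_EFinP/measurable_funTS; exact: measurable_uniform_pdf.
  - by move=> z _; rewrite lee_fin uniform_pdf_ge0.
apply: (@le_trans _ _ (\int[lebesgue_measure]_(z in I1 `|` I2) (cst 1 z))%E).
  apply: ge0_le_integral => //.
  - exact: measurableU.
  - by move=> z _; rewrite lee_fin uniform_pdf_ge0.
  - apply/measurable_EFinP/measurable_funTS; exact: measurable_uniform_pdf.
  - move=> z _; rewrite lee_fin /uniform_pdf; case: ifP => _ //.
    by rewrite subr0 invr1.
rewrite integral_cst ?mul1e; last exact: measurableU.
apply: le_trans (measureU2 lebesgue_measure mI1 mI2) _.
have lenI (a : R) : lebesgue_measure `[a - y, a - x[ = (y - x)%:E.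
  rewrite lebesgue_measure_itv /= lte_fin ltrD2l ltrN2.
  case: ltP => yx; first by rewrite -EFinD; congr (_%:E); lra.
  by congr (_%:E); apply/eqP; rewrite eq_sym subr_eq0 eq_le yx xy.
rewrite [X in (X + _)%E](lenI n) [X in (_ + X)%E](lenI (n + 1)) -EFinD lee_fin distrC.
by rewrite ger0_norm ?subr_ge0 // mulr_natl mulr2n.
Qed.

End RandomShift.

(** * Expectation under a bound by weighted events *)

Section ExpectationBound.
Variables (d : measure_display) (T : measurableType d) (R : realType) (P : probability T R).
Local Open Scope classical_set_scope.

(** By linearity only the individual probabilities of the events enter, which lets one shift serve
    every scale and coordinate. *)
Lemma expectation_le_sum (I : Type) (s : seq I) (f : T -> R) (c : R) (a q : I -> R)
    (b : I -> T -> bool) :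
  measurable_fun setT f -> (forall w, 0 <= f w) -> 0 <= c -> (forall i, 0 <= a i) ->
  (forall i, measurable_fun setT (b i)) ->
  (forall w, f w <= c + \sum_(i <- s) a i * (b i w)%:R) ->
  (forall i, P [set w | b i w] <= (q i)%:E)%E ->
  (\int[P]_w (f w)%:E <= (c + \sum_(i <- s) a i * q i)%:E)%E.
Proof.
move=> mf f0 c0 a0 mb fle Pb.
have bE i : (fun w => (b i w)%:R) = \1_[set w | b i w] :> (T -> R).
  apply/funext => w; rewrite indicE; congr (_%:R).
  by congr nat_of_bool; apply/idP/idP; rewrite inE.
have mset i : measurable [set w | b i w].
  by have := mb i measurableT [set true]; rewrite setTI; apply.
have mbR i : measurable_fun setT (fun w => (b i w)%:R : R).
  by rewrite bE; exact: measurable_indic.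
have mterm i : measurable_fun setT (fun w => (a i * (b i w)%:R)%:E).
  by apply/measurable_EFinP/measurable_funM.
apply: (@le_trans _ _ (\int[P]_w (c%:E + \sum_(i <- s) (a i * (b i w)%:R)%:E))%E).
  apply: ge0_le_integral => //.
  - by move=> w _; rewrite lee_fin.
  - exact/measurable_EFinP.
  - by apply: emeasurable_funD => //; apply: emeasurable_sum.
  - by move=> w _; rewrite sumEFin -EFinD lee_fin.
rewrite ge0_integralD //; first last.
- by apply: emeasurable_sum.
- by move=> w _; apply: sume_ge0 => i _; rewrite lee_fin mulr_ge0.
have -> : (\int[P]_w c%:E = c%:E)%E.
  by rewrite integral_cst // -[RHS]mule1; congr (_ * _)%E; exact: probability_setT.
rewrite EFinD leeD2l //.
rewrite ge0_integral_sum //; last by move=> i w _; rewrite lee_fin mulr_ge0.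
rewrite -sumEFin; apply: lee_sum => i _.
under eq_integral do rewrite EFinM.
rewrite ge0_integralZl_EFin //; last exact/measurable_EFinP.
rewrite EFinM lee_wpmul2l ?lee_fin //.
rewrite (_ : (fun x => _) = (fun x => (\1_[set w | b i w] x)%:E)); last first.
  by apply/funext => w; rewrite -bE.
by rewrite integral_indic // setIT; exact: Pb.
Qed.

End ExpectationBound.

(** * Shifted grids at all scales *)

Section Embedding.
Variables (R : realType) (D : nat).
Implicit Types (u v x : pt R D) (s : seq (upd R D)) (w : R) (i : int).

(** A negated finite disjunction of [split_by] events, so that measurability and union bounds go
    coordinate by coordinate. *)
Definition same_cell i w : rel (pt R D) := fun u v =>
  ~~ has (fun k : 'I_D => split_by (u ord0 k / 2 ^ i) (v ord0 k / 2 ^ i) w) (enum 'I_D).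

Lemma same_cellP i w u v :
  reflect (forall k, Num.floor (u ord0 k / 2 ^ i + w) = Num.floor (v ord0 k / 2 ^ i + w))
          (same_cell i w u v).
Proof.
apply: (iffP hasPn) => [uv k|uv k _]; last by rewrite /split_by uv eqxx.
by apply/eqP; have := uv k (mem_enum _ k); rewrite negbK.
Qed.

Lemma same_cell_refl i w : reflexive (same_cell i w).
Proof. by move=> u; apply/same_cellP. Qed.

Lemma same_cell_sym i w : symmetric (same_cell i w).
Proof. by move=> u v; apply/same_cellP/same_cellP => uv k; rewrite uv. Qed.

Lemma same_cell_trans i w : transitive (same_cell i w).
Proof.
move=> v u x /same_cellP uv /same_cellP vx; apply/same_cellP => k.
by rewrite uv vx.
Qed.

Lemma same_cell_linf i w u v : same_cell i w u v -> linf u v <= 2 ^ i.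
Proof.
have i0 := exp2z_gt0 R i; move/same_cellP => uv; apply/linf_leP => [|k]; first exact: ltW.
suff: `|u ord0 k / 2 ^ i - v ord0 k / 2 ^ i| <= 1.
  by rewrite -mulrBl normrM normfV (gtr0_norm i0) ler_pdivrMr // mul1r.
have := floor_itv (u ord0 k / 2 ^ i + w); have := floor_itv (v ord0 k / 2 ^ i + w).
rewrite (uv k); move: (Num.floor _) => n; rewrite intrD.
move: (u ord0 k / 2 ^ i) (v ord0 k / 2 ^ i) n%:~R => a b c /andP[h1 h2] /andP[h3 h4].
by rewrite ler_norml; apply/andP; split; lra.
Qed.

Lemma measurable_same_cell i u v : measurable_fun setT (fun w => same_cell i w u v).
Proof.
apply: measurable_neg; apply: measurable_fun_has => k.
exact: measurable_split_by.
Qed.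

(** * The supremum ultrametric and its expectation *)

Definition clustered i w s : rel (pt R D) := same_cluster (same_cell i w) (2 ^ i) s.

(** Enumerating the scales makes the supremum one of a sequence, hence measurable. A number that
    codes no integer gives 0, which merely repeats a scale. *)
Definition scale (n : nat) : int := odflt 0 (unpickle n).

Lemma scale_pickle i : scale (pickle i) = i.
Proof. by rewrite /scale pickleK. Qed.

Definition gap w s u v (n : nat) : R :=
  if clustered (scale n) w s u v then 0 else 8 * 2 ^ scale n.

(* The scales are unrelated partitions: taking the supremum of their
   ultrametrics makes nestedness across scales unnecessary. *)
Definition hdist w s u v : R := sup (range (gap w s u v)).

Lemma gap_ge0 w s u v n : 0 <= gap w s u v n.
Proof. by rewrite /gap; case: ifP => // _; rewrite mulr_ge0 ?exp2z_ge0. Qed.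

Lemma clusteredP i w s :
  cluster_inv (same_cell i w) (2 ^ i) (alive s) (clustered i w s).
Proof.
apply: clusterP; [exact: same_cell_refl|exact: same_cell_sym|exact: same_cell_trans| |].
- exact: same_cell_linf.
- exact: exp2z_ge0.
Qed.

(** If [2 ^ j <= x < 2 ^ (j + 1)], the two inequalities give [j <= i + 2] and [i < j + 2], leaving
    four exponents. *)
Lemma annulus_scales (x : R) : exists N : seq int,
  (size N <= 4)%N /\ forall i, 2 ^ i / 2 < x <= 4 * 2 ^ i -> i \in N.
Proof.
have [x0|x0] := leP x 0.
  exists [::]; split => // i /andP[ix _]; have := exp2z_gt0 R i; lra.
have [j /andP[jx xj]] := dyadic_bracket x0.
exists [:: j - 2; j - 1; j; j + 1]; split => // i /andP[ix xi].
have h1 : j <= i + 2.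
  by rewrite -(ler_eXz2l (x := 2 : R)) ?ltr1n // exp2z_D2; apply: le_trans jx xi.
have h2 : i < j + 2.
  rewrite -(ltr_eXz2l (x := 2 : R)) ?ltr1n // (_ : j + 2 = j + 1 + 1); last by lia.
  by rewrite exp2zD expr1z; move: (2 ^ i) (2 ^ (j + 1)) ix xj => a b; lra.
by rewrite !inE; lia.
Qed.

Lemma nonisolated_scales (L : seq (pt R D)) u : exists N : seq int,
  (size N <= 4 * size L)%N /\ forall i, ~~ isolated_in (2 ^ i) L u -> i \in N.
Proof.
elim: L => [|x L [N [sN hN]]]; first by exists [::]; split.
have [N' [sN' hN']] := annulus_scales (linf x u).
exists (N' ++ N); split; first by rewrite size_cat mulnS leq_add.
move=> i /=; rewrite negb_and negb_imply mem_cat => /orP[/andP[h1 h2]|/hN ->]; last first.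
  by rewrite orbT.
by rewrite hN' // h1 andbT ltNge.
Qed.

Definition splits u v (p : int * 'I_D) : R -> bool :=
  split_by (u ord0 p.2 / 2 ^ p.1) (v ord0 p.2 / 2 ^ p.1).

(** The list [N], covering the scales where [u] is not isolated, is chosen before [w] and [n], so
    the bound survives the supremum over scales and can then be integrated. *)
Lemma gap_le s u v : u \in alive s -> exists N : seq int,
  (size N <= 4 * size (alive s))%N /\ forall w n,
  gap w s u v n <= 16 * linf u v +
    \sum_(p <- [seq (i, k) | i <- N, k <- enum 'I_D]) (8 * 2 ^ p.1) * (splits u v p w)%:R.
Proof.
move=> us; have [N [sN hN]] := nonisolated_scales (alive s) u; exists N; split => // w n.
set S := \sum_(p <- _) _.
have term0 (p : int * 'I_D) : 0 <= (8 * 2 ^ p.1) * (splits u v p w)%:R :> R.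
  by rewrite mulr_ge0 ?ler0n // mulr_ge0 ?exp2z_ge0.
have S0 : 0 <= S by apply: sumr_ge0 => p _.
have uv0 := linf_ge0 u v.
rewrite /gap; case: ifPn => [_|ncl]; first by lra.
move: (scale n) ncl => i ncl; have i0 := exp2z_gt0 R i.
have [nsame iso_far] := not_cluster (ltW i0) us ncl.
(* At an isolated scale [2 ^ i / 2 < linf u v], so [8 * 2 ^ i] stays below [16 * linf u v]. *)
have [iso|/hN iN] := boolP (isolated_in (2 ^ i) (alive s) u).
  move: (iso_far iso) uv0 S0 i0; move: (linf u v) (2 ^ i) S => a b c; lra.
move: nsame; rewrite negbK => /hasP[k kD ksplit].
have pN : (i, k) \in [seq (i, k) | i <- N, k <- enum 'I_D].
  by apply/allpairsP; exists (i, k).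
have : 8 * 2 ^ i <= S.
  rewrite /S (big_rem _ pN) /= /splits /= ksplit mulr1 lerDl.
  by apply: sumr_ge0 => p _; apply: term0.
move: uv0 S0; move: (linf u v) (2 ^ i) S => a b c; lra.
Qed.

Lemma gap_ubound w s u v : u \in alive s -> has_ubound (range (gap w s u v)).
Proof.
move=> us; have [N [_ hN]] := gap_le v us.
eexists => _ [n _ <-]; exact: hN.
Qed.

Lemma gap_le_hdist w s u v n : u \in alive s -> gap w s u v n <= hdist w s u v.
Proof. by move=> us; apply: ub_le_sup; [exact: gap_ubound|exists n]. Qed.

Lemma hdist_le w s u v (B : R) : (forall n, gap w s u v n <= B) -> hdist w s u v <= B.
Proof.
move=> gB; apply: ge_sup; first by exists (gap w s u v 0%N); exists 0%N.
by move=> _ [n _ <-].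
Qed.

Lemma hdist_ge0 w s u v : u \in alive s -> 0 <= hdist w s u v.
Proof. by move=> us; apply: le_trans (gap_le_hdist w v 0%N us); apply: gap_ge0. Qed.

Lemma linf_le_hdist w s u v : u \in alive s -> v \in alive s ->
  linf u v <= hdist w s u v.
Proof.
move=> us vs; have [->|uv] := eqVneq u v; first by rewrite linfxx hdist_ge0.
have [j /andP[jd dj]] := dyadic_bracket (linf_gt0 uv).
(* Clusters at scale [j - 2] have diameter at most [3 * 2 ^ (j - 2) < 2 ^ j], so they separate the
   pair; the factor 8 in [gap] makes the gap there [2 ^ (j + 1)]. *)
apply: le_trans (gap_le_hdist w v (pickle (j - 2)) us).
have j0 := exp2z_gt0 R (j - 2).
have e1 : 2 ^ j = 4 * (2 : R) ^ (j - 2).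
  by rewrite -exp2z_D2 subrK.
rewrite exp2zD expr1z {}e1 in jd dj.
rewrite /gap scale_pickle; case: ifPn => [cl|_]; last by move: (2 ^ (j - 2)) dj => a; lra.
have := cluster_linf (@same_cell_refl _ _) (@same_cell_sym _ _) (@same_cell_trans _ _)
  (@same_cell_linf _ _) (ltW j0) us vs cl.
by move: jd j0; move: (linf u v) (2 ^ (j - 2)) => a b; lra.
Qed.

(** At each scale, a cluster boundary between [u] and [x] also separates [u] from [v] or [v] from
    [x]. Positivity is inherited from [linf]. *)
Lemma hdist_ultrametric w s : ultrametric_on (alive s) (hdist w s).
Proof.
split => [u v us vs uv|u v us vs|u v x us vs xs].
- exact: lt_le_trans (linf_gt0 uv) (linf_le_hdist w us vs).
- rewrite /hdist (_ : gap w s u v = gap w s v u) //; apply/funext => n.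
  have [_ csym _ _] := clusteredP (scale n) w s.
  rewrite /gap (_ : clustered _ _ _ u v = clustered (scale n) w s v u) //.
  by apply/idP/idP; apply: csym.
- apply: hdist_le => n; rewrite {1}/gap; case: ifPn => [_|ux].
    by rewrite le_max hdist_ge0.
  have [uv|uv] := boolP (clustered (scale n) w s u v).
    have [vx|vx] := boolP (clustered (scale n) w s v x).
      have [_ _ ctrans _] := clusteredP (scale n) w s.
      by move: ux; rewrite (ctrans v u x).
    have := gap_le_hdist w x n vs; rewrite {1}/gap (negbTE vx) => h.
    by rewrite le_max h orbT.
  have := gap_le_hdist w v n us; rewrite {1}/gap (negbTE uv) => h.
  by rewrite le_max h.
Qed.

Lemma hdist_mono w s (e : upd R D) u v : u \in alive s -> v \in alive s ->
  hdist w (rcons s e) u v <= hdist w s u v.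
Proof.
move=> us vs; apply: hdist_le => n; apply: le_trans (gap_le_hdist w v n us).
rewrite /gap; case: ifPn => [_|ncl]; first exact: gap_ge0.
case: ifPn => // cl; case/negP: ncl; apply: cluster_mono => //.
exact: same_cell_refl.
Qed.

Lemma measurable_hdist s u v : u \in alive s ->
  measurable_fun setT (fun w => hdist w s u v).
Proof.
move=> us.
rewrite (_ : (fun w => _) = fun w => sups (fun n => gap w s u v n) 0%N); last first.
  apply/funext => w; rewrite /hdist /sups /=; congr sup; apply/seteqP; split => _ [n _ <-]; exists n => //.
apply: (measurable_fun_sups (h := fun n w => gap w s u v n)) => [w _|n].
  exact: gap_ubound.
apply: measurable_fun_ifT; [|exact: measurable_cst|exact: measurable_cst].
apply: measurable_cluster => a b; exact: measurable_same_cell.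
Qed.

(** A scale and a coordinate cost [8 * 2 ^ i] with probability at most [2 * |u_k - v_k| / 2 ^ i], on
    average at most [16 * linf u v]; at most [4 * size (alive s) * D] such pairs occur, whence
    64. *)
Lemma expectation_hdist s u v : u \in alive s ->
  (\int[shift_law R]_w (hdist w s u v)%:E
     <= ((16 + 64 * D%:R * (size (alive s))%:R) * linf u v)%:E)%E.
Proof.
move=> us; have [N [sN hN]] := gap_le v us.
set a := fun p : int * 'I_D => 8 * (2 : R) ^ p.1.
set q := fun p : int * 'I_D => 2 * `|u ord0 p.2 / 2 ^ p.1 - v ord0 p.2 / 2 ^ p.1|.
set pairs := [seq (i, k) | i <- N, k <- enum 'I_D].
have aq p : a p * q p <= 16 * linf u v.
  have p0 := exp2z_gt0 R p.1.
  suff -> : a p * q p = 16 * `|u ord0 p.2 - v ord0 p.2| by rewrite ler_pM2l ?ler_linf.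
  rewrite /a /q -mulrBl normrM normfV (gtr0_norm p0).
  by field; rewrite gt_eqF.
have bound : (\int[shift_law R]_w (hdist w s u v)%:E
    <= (16 * linf u v + \sum_(p <- pairs) a p * q p)%:E)%E.
  apply: (@expectation_le_sum _ _ R (shift_law R) _ pairs
    (fun w => hdist w s u v) (16 * linf u v) a q (splits u v)).
  - exact: measurable_hdist.
  - by move=> w; apply: hdist_ge0.
  - by rewrite mulr_ge0 ?linf_ge0.
  - by move=> p; rewrite mulr_ge0 ?exp2z_ge0.
  - by move=> p; apply: measurable_split_by.
  - by move=> w; apply: hdist_le => n; apply: hN.
  - by move=> p; apply: shift_law_split.
apply: le_trans bound _; rewrite lee_fin [leRHS]mulrDl lerD2l.
apply: le_trans (ler_sum _ (fun p _ => aq p)) _.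
rewrite big_const_seq count_predT iter_addr_0 size_allpairs size_enum_ord -[leLHS]mulr_natl natrM.
rewrite mulrA ler_wpM2r ?linf_ge0 //.
rewrite (_ : 64 * D%:R * _ = (4 * size (alive s))%:R * D%:R * 16); last by rewrite natrM; ring.
by rewrite ler_wpM2r // ler_wpM2r // ler_nat.
Qed.

(** * The random trees and their expected distances *)

Definition represents w s (T : tree R D) : Prop :=
  [/\ perm_eq (leaves T) (alive s), hst_ok 1 T &
      {in alive s &, forall u v, u != v -> lca_weight T u v = hdist w s u v}].

(** The choice depends only on [w] and the prefix [s], so it is online by construction. [Leaf 0] is
    returned only when no point is alive. *)
Definition embedding w s : tree R D :=
  if pselect (exists T, represents w s T) is left ex then sval (cid ex) else Leaf 0.

Lemma embeddingP w s : alive s != [::] -> represents w s (embedding w s).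
Proof.
move=> s0; rewrite /embedding; case: pselect => [ex|[]]; first exact: svalP.
have [T [leavesT okT lcaT _]] := ultrametric_tree (alive_uniq s) s0 (hdist_ultrametric w s).
by exists T.
Qed.

Lemma hst_dist_embedding w s u v : u \in alive s -> v \in alive s ->
  hst_dist (embedding w s) u v = if u == v then 0 else hdist w s u v.
Proof.
move=> us vs; have s0 : alive s != [::] by apply: contraTneq us => ->.
rewrite /hst_dist; case: eqVneq => // uv.
by have [_ _] := embeddingP w s0; apply.
Qed.

Lemma embedding_online_monotone w : online_monotone_embedding (embedding w).
Proof.
move=> s; split=> [s0|].
  have [leavesT okT _] := embeddingP w s0.
  by split => //; exists 1.
split=> [u v us vs|e u v us vs us' vs'].
  rewrite hst_dist_embedding //; case: eqVneq => [->|_]; first by rewrite linfxx.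
  exact: linf_le_hdist.
by rewrite !hst_dist_embedding //; case: eqVneq => // _; apply: hdist_mono.
Qed.

Lemma expectation_embedding s u v : u \in alive s -> v \in alive s ->
  measurable_fun setT (fun w => hst_dist (embedding w s) u v) /\
  (\int[shift_law R]_w (hst_dist (embedding w s) u v)%:E
     <= (80 * D%:R * (size (alive s))%:R * linf u v)%:E)%E.
Proof.
move=> us vs; rewrite (_ : (fun w => _) = fun w => if u == v then 0 else hdist w s u v); last first.
  by apply/funext => w; rewrite hst_dist_embedding.
under eq_integral do rewrite hst_dist_embedding //.
have [<-|uv] := eqVneq u v.
  by rewrite integral0 linfxx mulr0; split.
split; first exact: measurable_hdist.
apply: le_trans (expectation_hdist v us) _; rewrite lee_fin ler_wpM2r ?linf_ge0 //.
(* Distinct points force [1 <= D], and [u] is alive, so 16 is at most [16 * D * size (alive s)];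
   with 64 this makes 80. *)
have D1 : 1 <= D%:R :> R.
  rewrite ler1n lt0n; apply: contraNneq uv => D0.
  by apply/eqP/rowP => k; have := ltn_ord k; rewrite {2}D0.
have n1 : 1 <= (size (alive s))%:R :> R by rewrite ler1n; case: (alive s) us.
have Dn : 1 <= D%:R * (size (alive s))%:R :> R by rewrite mulr_ege1.
by rewrite -!mulrA; move: (D%:R * _) Dn => x; lra.
Qed.

End Embedding.

(** * The distortion bound in terms of the width *)

Theorem mainTheorem19 (R : realType) :
  exists C : R, 0 < C /\
  forall D : nat,
  exists (d : measure_display) (Omega : measurableType d)
         (P : probability Omega R) (A : Omega -> seq (upd R D) -> tree R D),
    (forall w, online_monotone_embedding (A w)) /\
    (forall (s : seq (upd R D)) (t : nat) (u v : pt R D),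
        u \in alive (take t s) -> v \in alive (take t s) ->
        measurable_fun setT (fun w => hst_dist (A w (take t s)) u v) /\
        (\int[P]_w (hst_dist (A w (take t s)) u v)%:E
           <= (C * D%:R * (width s)%:R * linf u v)%:E)%E).
Proof.
exists 80; split => // D.
exists _, (measurableTypeR R), (shift_law R), (@embedding R D); split.
  exact: embedding_online_monotone.
move=> s t u v us vs; have [mdist le_dist] := expectation_embedding us vs.
split => //; apply: le_trans le_dist _; rewrite lee_fin ler_wpM2r ?linf_ge0 //.
by rewrite ler_wpM2l ?mulr_ge0 // ler_nat size_alive_le_width.
Qed.
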